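(* Let $p$ be an odd prime, let $q\in\mathbb{C}_p$ with $|q-1|_p<p^{-1/(p-1)}$, and let $h\in\mathbb{Z}$. For all positive integers $n,v$, $$E_{n,q}^{(h,v)}=\sum_{\substack{l_1,l_2,\dots,l_v\ge 0\\ l_1+l_2+\cdots+l_v=n}}\binom{n}{l_1,l_2,\dots,l_v}\prod_{j=1}^{v}E_{l_j,q}^{(h)}.$$
   Context: $\mathbb{C}_p$ is the completion of an algebraic closure of $\mathbb{Q}_p$, with absolute value normalized by $|p|_p=p^{-1}$. For $x\in\mathbb{Z}_p$, $q^{x}=\exp(x\log q)$. Fermionic integral: for a uniformly differentiable function $f:\mathbb{Z}_p\to\mathbb{C}_p$, $\int_{\mathbb{Z}_p} f(x)\,d\mu_{-1}(x)=\lim_{N\to\infty}\sum_{x=0}^{p^N-1}f(x)(-1)^x$. Multiple integrals are iterated integrals. The $(h,q)$-extension of Euler numbers $E_{n,q}^{(h)}$ is defined by the generating function $$\frac{2}{q^{h}e^{t}+1}=\sum_{n=0}^{\infty}E_{n,q}^{(h)}\frac{t^n}{n!}.$$ The higher-order $(h,q)$-Euler numbers $E_{n,q}^{(h,v)}$ ($v$ a positive integer) are defined, for $t\in\mathbb{C}_p$ sufficiently close to $0$, by $$\int_{\mathbb{Z}_p}\cdots\int_{\mathbb{Z}_p}q^{\sum_{j=1}^{v}hx_j}\exp\Big(t\sum_{j=1}^{v}x_j\Big)\prod_{j=1}^{v}d\mu_{-1}(x_j)=\sum_{n=0}^{\infty}E_{n,q}^{(h,v)}\frac{t^n}{n!}$$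 ($v$-fold integral), equivalently by the generating function $\left(\frac{2}{q^{h}e^{t}+1}\right)^{v}=\sum_{n=0}^{\infty}E_{n,q}^{(h,v)}\frac{t^n}{n!}$. The multinomial coefficient is $\binom{n}{l_1,\dots,l_v}=\frac{n!}{l_1!\cdots l_v!}$. *)

(* Defs.v *)
(* MathComp / MathComp-Analysis *)
From HB Require Import structures.
From mathcomp Require Import all_boot all_order all_algebra.
From mathcomp Require Import all_classical all_reals all_analysis.

Set Implicit Arguments.
Unset Strict Implicit.
Unset Printing Implicit Defensive.
Import Order.TTheory GRing.Theory Num.Theory.

Local Open Scope classical_set_scope.
Local Open Scope ring_scope.

Record ultrametricField (R : realType) := UltrametricField {
  uf_field : fieldType;
  uf_abs : uf_field -> R;
  uf_abs_ge0 : forall x, 0 <= uf_abs x;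
  uf_abs_eq0 : forall x, (uf_abs x == 0) = (x == 0);
  uf_absM : forall x y, uf_abs (x * y) = uf_abs x * uf_abs y;
  uf_absD : forall x y, uf_abs (x + y) <= Num.max (uf_abs x) (uf_abs y)
}.

Definition uf_sort (R : realType) (K : ultrametricField R) : Type :=
  uf_field K.
Coercion uf_sort : ultrametricField >-> Sortclass.

HB.instance Definition _ (R : realType) (K : ultrametricField R) :=
  GRing.Field.copy (uf_sort K) (uf_field K).
HB.instance Definition _ (R : realType) (K : ultrametricField R) :=
  isPointed.Build (uf_sort K) 0.

(* Not the norm of a normedZmodType, whose axioms (`|x *+ n| = `|x| *+ n) rule
   out non-archimedean absolute values. *)
Definition abs (R : realType) (K : ultrametricField R) (x : K) : R := uf_abs x.

Section UltrametricTopology.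
Context {R : realType} (K : ultrametricField R).
Implicit Types x y z : K.

Definition dist x y : R := abs (x - y).

Fact absN x : abs (- x) = abs x.
Proof.
have sqr_inj (a b : R) : 0 <= a -> 0 <= b -> a * a = b * b -> a = b.
  by move=> a0 b0 e; apply/eqP; rewrite -(@eqrXn2 _ 2)// !expr2 e.
by apply: sqr_inj; rewrite ?uf_abs_ge0// /abs -!uf_absM mulrNN.
Qed.

Fact dist_xx x : dist x x = 0.
Proof. by apply/eqP; rewrite /dist subrr /abs uf_abs_eq0. Qed.

Fact dist_positivity x y : dist x y = 0 -> x = y.
Proof. by move/eqP; rewrite /dist /abs uf_abs_eq0 subr_eq0 => /eqP. Qed.

Fact dist_sym x y : dist x y = dist y x.
Proof. by rewrite /dist -opprB absN. Qed.

Fact dist_triangle y x z : dist x z <= dist x y + dist y z.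
Proof.
rewrite /dist -[x - z](subrKA y); apply: le_trans (uf_absD _ _) _.
by rewrite ge_max lerDl lerDr !uf_abs_ge0.
Qed.

HB.instance Definition _ := @isMetric.Build R (uf_sort K) dist
  dist_xx dist_positivity dist_sym dist_triangle.

End UltrametricTopology.

Section PadicSubfields.
Context {R : realType} (K : ultrametricField R).

(* When abs p = 1 / p, the absolute value restricts to the p-adic one on the
   prime field, so that for K complete this is Q_p. *)
Definition Qp : set K := closure (range (ratr : rat -> K)).

(* The elements of K that are algebraic over Q_p. *)
Definition Qpbar : set K :=
  [set x | exists P : {poly K}, [/\ P != 0, forall i, Qp P`_i & root P x]].

End PadicSubfields.

(* C_p, the completion of an algebraic closure of Q_p: a complete field in
   which the elements algebraic over Q_p are dense and form an algebraically
   closed field. This determines K up to isometric isomorphism. *)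
Record padicComplex (R : realType) (p : nat) := PadicComplex {
  Cp_field :> ultrametricField R;
  Cp_complete :
    forall F : set_system Cp_field, ProperFilter F -> cauchy F -> cvg F;
  Cp_absp : abs (p%:R : Cp_field) = p%:R^-1;
  Cp_Qpbar_closed : forall P : {poly Cp_field}, (1 < size P)%N ->
    (forall i, Qpbar P`_i) -> exists2 x : Cp_field, Qpbar x & root P x;
  Cp_Qpbar_dense : closure (Qpbar (K := Cp_field)) = setT
}.

Section Euler.
Context {R : realType} {p : nat} {K : padicComplex R p}.

Definition padic_exp (x : K) : K :=
  lim (series (fun n => x ^+ n / n`!%:R) @ \oo).

Definition padic_log (x : K) : K :=
  lim (series (fun n => (-1) ^+ n * (x - 1) ^+ n.+1 / n.+1%:R) @ \oo).

(* q ^ x for x in Z_p, and in particular for x an integer. *)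
Definition padic_pow (q x : K) : K := padic_exp (x * padic_log q).

(* Only the values of f on Z_p (in fact on the natural numbers) matter. *)
Definition fermionic_int (f : K -> K) : K :=
  lim ((fun N : nat => \sum_(0 <= x < p ^ N) f x%:R * (-1) ^+ x) @ \oo).

Fixpoint fermionic_mint (v : nat) : (v.-tuple K -> K) -> K :=
  match v with
  | 0 => fun f => f [tuple]
  | v'.+1 => fun f =>
      fermionic_int (fun x => fermionic_mint (fun s => f [tuple of x :: s]))
  end.

(* F t = \sum_n E_n t^n / n! for t sufficiently close to 0. *)
Definition is_egf (F : K -> K) (E : nat -> K) : Prop :=
  \forall t \near (0 : K),
    series (fun n => E n * (t ^+ n / n`!%:R)) @ \oo --> F t.

(* The sequence with exponential generating function F, which is unique when
   it exists. *)
Definition egf_coef (F : K -> K) : nat -> K := get (is_egf F).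

(* E_{n,q}^{(h)} *)
Definition hq_euler (h : int) (q : K) : nat -> K :=
  egf_coef (fun t => 2 / (padic_pow q h%:~R * padic_exp t + 1)).

(* E_{n,q}^{(h,v)} *)
Definition hq_euler_order (h : int) (v : nat) (q : K) : nat -> K :=
  egf_coef (fun t => fermionic_mint (fun x : v.-tuple K =>
    padic_pow q (\sum_(j < v) h%:~R * tnth x j) *
    padic_exp (t * \sum_(j < v) tnth x j))).

Definition multinomial (n v : nat) (l : {ffun 'I_v -> 'I_n.+1}) : K :=
  n`!%:R / \prod_(j < v) (l j)`!%:R.

End Euler.

(* Main.v *)
Require Import Defs.
From mathcomp Require Import all_boot all_order all_algebra.
From mathcomp Require Import ring lra zify.
From mathcomp Require Import all_classical all_reals all_analysis.

Set Implicit Arguments.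
Unset Strict Implicit.
Unset Printing Implicit Defensive.
Import Order.TTheory GRing.Theory Num.Theory.

Local Open Scope ring_scope.

(** For |t| < r = p ^ (- 1 / (p - 1)) and c = q ^ h, the element w = c e ^ t
    satisfies |w - 1| < 1, and everything rests on two evaluations.

    - On the integral side, q ^ (h x) e ^ (t x) = w ^ x for natural numbers x.
      As p is odd, the partial sums of the fermionic integral of w ^ x are
      (w ^ (p ^ N) + 1) / (w + 1), and they tend to 2 / (w + 1), because
      w ^ (p ^ N) tends to 1. Iterating, the v-fold integral is
      (2 / (w + 1)) ^ v [fermionic_mint_geometric].

    - On the series side, the relation E * (c e ^ t + 1) = 2 can be solved
      degree by degree, with division by c + 1 only. As |c + 1| = |2| = 1, the
      solution has coefficients of absolute value at most 1
      [unit_bounded_euler_coef], so its exponential generating function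
      converges on the whole disc |t| < r, with sum 2 / (c e ^ t + 1)
      [egf_at_euler_coef].

    Sequences bounded by 1 are closed under binomial convolution, which
    corresponds to the product of the sums on the disc [egf_at_binconv]. Hence
    the v-fold binomial convolution of the Euler numbers has the v-fold
    integral as generating function. Coefficients of a convergent generating
    function are unique [is_egf_unique], so this convolution is the sequence
    of Euler numbers of order v, and expanding it gives the multinomial sum
    [binconv_pow_multinomial].

    Both the disc |t| < r and the bound |log q| < r come from a single
    estimate, |n!| >= r ^ (n - 1) [abs_fact_ge], which is Legendre's formula
    for the exponent of p in n!. *)

(** * Ultrametric absolute values and convergence *)

Section RealGeometric.
Import numFieldNormedType.Exports.
Local Open Scope classical_set_scope.

Lemma geometric_lt (R : realType) (C rho e : R) : 0 <= rho < 1 -> 0 < e ->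
  exists N, forall n, (N <= n)%N -> C * rho ^+ n < e.
Proof.
move=> /andP[rho0 rho1] e0.
have rho1' : `|rho| < 1 by rewrite ger0_norm.
have /cvgrPdist_lt/(_ e e0)[N _ H] := @cvg_geometric R C rho rho1'.
exists N => n /H; rewrite /geometric /= sub0r normrN.
by apply: le_lt_trans; rewrite ler_norm.
Qed.

End RealGeometric.

Section Ultrametric.
Context {R : realType} {K : ultrametricField R}.
Implicit Types (x y a b : K) (u : nat -> K).
Local Open Scope classical_set_scope.

Lemma abs_ge0 x : 0 <= abs x. Proof. exact: uf_abs_ge0. Qed.

Lemma abs_eq0 x : (abs x == 0) = (x == 0). Proof. exact: uf_abs_eq0. Qed.

Lemma abs0 : abs (0 : K) = 0. Proof. by apply/eqP; rewrite abs_eq0. Qed.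

Lemma absM x y : abs (x * y) = abs x * abs y. Proof. exact: uf_absM. Qed.

Lemma abs1 : abs (1 : K) = 1.
Proof.
have n0 : abs (1 : K) != 0 by rewrite abs_eq0 oner_neq0.
by apply: (mulfI n0); rewrite -absM !mulr1.
Qed.

Lemma absX x n : abs (x ^+ n) = abs x ^+ n.
Proof. by elim: n => [|n IH]; rewrite ?expr0 ?abs1// !exprS absM IH. Qed.

Lemma absV x : abs x^-1 = (abs x)^-1.
Proof.
have [->|x0] := eqVneq x 0; first by rewrite invr0 abs0 invr0.
have ax0 : abs x != 0 by rewrite abs_eq0.
by apply: (mulfI ax0); rewrite -absM !mulfV// abs1.
Qed.

Lemma absB x y : abs (x - y) = abs (y - x).
Proof. by rewrite -opprB absN. Qed.

Lemma absD_le M x y : abs x <= M -> abs y <= M -> abs (x + y) <= M.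
Proof. by move=> xM yM; rewrite (le_trans (uf_absD _ _))// ge_max xM. Qed.

Lemma absD_lt M x y : abs x < M -> abs y < M -> abs (x + y) < M.
Proof. by move=> xM yM; rewrite (le_lt_trans (uf_absD _ _))// gt_max xM. Qed.

Lemma abs_sum_le M (I : Type) (s : seq I) (P : pred I) (F : I -> K) :
  0 <= M -> (forall i, P i -> abs (F i) <= M) ->
  abs (\sum_(i <- s | P i) F i) <= M.
Proof.
move=> M0 FM; elim/big_ind : _ => //; first by rewrite abs0.
by move=> x y; apply: absD_le.
Qed.

Lemma abs_natr_le1 n : abs (n%:R : K) <= 1.
Proof.
elim: n => [|n IH]; first by rewrite abs0.
by rewrite -natr1 absD_le// abs1.
Qed.

Lemma abs_intr_le1 (m : int) : abs (m%:~R : K) <= 1.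
Proof. by case: m => n; rewrite ?NegzE ?rmorphN ?absN abs_natr_le1. Qed.

(** If abs y were larger than abs (x + y), then y = - x + (x + y) would be a
    sum of two strictly smaller terms. *)
Lemma abs_perturb x y : abs x < abs y -> abs (x + y) = abs y.
Proof.
move=> xy; apply/le_anti/andP; split; first by rewrite absD_le// ltW.
rewrite leNgt; apply/negP => lt; have : abs y < abs y; last by rewrite ltxx.
by rewrite -{1}[y](addKr x) absD_lt// absN.
Qed.

Lemma cvg_absP u a :
  u @ \oo --> a <->
  forall e, 0 < e -> exists N, forall n, (N <= n)%N -> abs (u n - a) < e.
Proof.
split=> [/cvg_ballP ua e e0|H].
  have [N _ uN] := ua e e0; exists N => n Nn.
  by have := uN n Nn; rewrite /= ballEmdist /= absB.
apply/cvg_ballP => e e0; have [N uN] := H e e0; exists N => // n Nn.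
by rewrite /= ballEmdist /= [mdist _ _]absB uN.
Qed.

Lemma cvg_abs_le u a b M : u @ \oo --> a ->
  (exists N, forall n, (N <= n)%N -> abs (u n - b) <= M) -> abs (a - b) <= M.
Proof.
move=> /cvg_absP ua [N0 uM]; rewrite leNgt; apply/negP => Mab.
have M0 : 0 <= M by rewrite (le_trans (abs_ge0 _) (uM N0 _)).
have [N uN] := ua _ (le_lt_trans M0 Mab).
have : abs (a - b) < abs (a - b); last by rewrite ltxx.
have {1}-> : a - b = (a - u (maxn N0 N)) + (u (maxn N0 N) - b) by ring.
apply: absD_lt.
  by rewrite absB uN// leq_maxr.
by rewrite (le_lt_trans _ Mab)// uM// leq_maxl.
Qed.

Lemma cvg_abs_geo u a (C rho : R) : 0 <= rho < 1 ->
  (forall n, abs (u n - a) <= C * rho ^+ n) -> u @ \oo --> a.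
Proof.
move=> rho01 ud; apply/cvg_absP => e e0.
have [N uN] := geometric_lt C rho01 e0; exists N => n Nn.
exact: le_lt_trans (ud n) (uN n Nn).
Qed.

Lemma ultra_cvg_lim u a : u @ \oo --> a -> lim (u @ \oo) = a.
Proof. by apply: cvg_lim; exact: metric_hausdorff. Qed.

Lemma ultra_cvg_unique u a b : u @ \oo --> a -> u @ \oo --> b -> a = b.
Proof. by move=> /ultra_cvg_lim <- /ultra_cvg_lim. Qed.

Lemma ultra_cvgD u v a b : u @ \oo --> a -> v @ \oo --> b ->
  (fun n => u n + v n) @ \oo --> a + b.
Proof.
move=> /cvg_absP ua /cvg_absP vb; apply/cvg_absP => e e0.
have [N1 H1] := ua e e0; have [N2 H2] := vb e e0; exists (maxn N1 N2) => n.
by rewrite geq_max => /andP[n1 n2]; rewrite opprD addrACA absD_lt ?H1 ?H2.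
Qed.

Lemma ultra_cvgM u v a b : u @ \oo --> a -> v @ \oo --> b ->
  (fun n => u n * v n) @ \oo --> a * b.
Proof.
move=> /cvg_absP ua /cvg_absP vb; apply/cvg_absP => e e0.
pose C := 1 + abs a + abs b.
have a0 := abs_ge0 a; have b0 := abs_ge0 b.
have C0 : 0 < C by rewrite /C; lra.
have [N1 H1] := ua _ ltr01.
have [N2 H2] := ua _ (divr_gt0 e0 C0); have [N3 H3] := vb _ (divr_gt0 e0 C0).
have small x y : abs x <= C -> abs y < e / C -> abs (x * y) < e.
  move=> xC ye; rewrite absM (@le_lt_trans _ _ (C * abs y))//.
    by rewrite ler_wpM2r ?abs_ge0.
  by rewrite -ltr_pdivlMl// mulrC.
have [C1 [Ca Cb]] : 1 <= C /\ abs a <= C /\ abs b <= C.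
  by rewrite /C; split; [|split]; lra.
exists (maxn N1 (maxn N2 N3)) => n; rewrite !geq_max => /and3P[n1 n2 n3].
have -> : u n * v n - a * b =
    (u n - a) * (v n - b) + (a * (v n - b) + b * (u n - a)).
  by ring.
rewrite !absD_lt ?small ?H2 ?H3//.
exact: le_trans (ltW (H1 _ n1)) C1.
Qed.

Lemma ultra_cvg_cst a : (fun _ : nat => a) @ \oo --> a.
Proof. exact: cvg_cst. Qed.

Lemma ultra_cvg_shift u a : (fun n => u n.+1) @ \oo --> a -> u @ \oo --> a.
Proof.
move=> /cvg_absP ua; apply/cvg_absP => e e0.
by have [N H] := ua e e0; exists N.+1 => -[//|n] /H.
Qed.

(** The left-hand side runs over the pairs (i, j) with i + j < N by diagonals,
    the right-hand side by rows. *)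
Lemma cauchy_prod_partial (a b : nat -> K) N :
  \sum_(0 <= n < N) \sum_(0 <= i < n.+1) a i * b (n - i)%N =
  \sum_(0 <= i < N) a i * series b (N - i)%N.
Proof.
elim: N => [|N IH]; first by rewrite !big_geq.
rewrite big_nat_recr//= IH; apply/esym.
have -> : \sum_(0 <= i < N.+1) a i * series b (N.+1 - i)%N =
    \sum_(0 <= i < N.+1) (a i * series b (N - i)%N + a i * b (N - i)%N).
  rewrite big_nat [RHS]big_nat; apply: eq_bigr => i /andP[_ iN].
  by rewrite -mulrDr subSn// /series /= big_nat_recr.
rewrite big_split/=; congr (_ + _).
have s0 : series b 0%N = 0 by rewrite /series /= big_geq.
by rewrite big_nat_recr//= subnn s0 mulr0 addr0.
Qed.

(** The product of the N-th partial sums exceeds the N-th partial sum of the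
    Cauchy product by the terms a i * b j with i, j < N <= i + j, each of size
    at most rho ^ N; an ultrametric sum of such terms is no larger. *)
Lemma cauchy_prod_cvg (a b : nat -> K) (rho : R) (A B : K) :
  0 <= rho < 1 ->
  (forall n, abs (a n) <= rho ^+ n) -> (forall n, abs (b n) <= rho ^+ n) ->
  series a @ \oo --> A -> series b @ \oo --> B ->
  series (fun n => \sum_(0 <= i < n.+1) a i * b (n - i)%N) @ \oo --> A * B.
Proof.
move=> rho01 aE bE aA bB; have /andP[rho0 rho1] := rho01.
(* minus the sum of the terms a i * b j with i, j < N <= i + j *)
pose D N := \sum_(0 <= i < N) a i * (series b (N - i)%N - series b N).
have D0 : D @ \oo --> (0 : K).
  apply: (@cvg_abs_geo D 0 1 rho) => // N; rewrite subr0 mul1r /D.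
  rewrite big_nat_cond; apply: abs_sum_le; first exact: exprn_ge0.
  move=> i /andP[/andP[_ iN] _]; rewrite absM.
  rewrite -[in leRHS](subnKC (ltnW iN)) exprD.
  apply: ler_pM; rewrite ?abs_ge0// absB /series /=.
  rewrite (big_cat_nat (leq0n _) (leq_subr i N))/= addrAC subrr add0r.
  rewrite big_nat_cond; apply: abs_sum_le; first exact: exprn_ge0.
  move=> j /andP[/andP[Nj _] _]; rewrite (le_trans (bE j))//.
  by rewrite ler_wiXn2l// ltW.
rewrite -[A * B]addr0.
have -> : series (fun n => \sum_(0 <= i < n.+1) a i * b (n - i)%N) =
    (fun N => series a N * series b N + D N).
  apply/funext => N; rewrite {1}/series /= cauchy_prod_partial.
  rewrite {1}/series /= mulr_suml -big_split /=.
  by apply: eq_bigr => i _; rewrite -mulrDr addrC subrK.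
exact: ultra_cvgD (ultra_cvgM aA bB) D0.
Qed.

End Ultrametric.

(** * The absolute value of n! and the radius of exp *)

(** Legendre's formula writes the exponent of p in n! as the sum of the
    n %/ p ^ k for k > 0. As p * (n %/ p ^ k.+1) <= n %/ p ^ k, the sum
    multiplied by p - 1 telescopes to at most n; the inequality is strict
    because the last nonzero quotient is at least 1. *)
Lemma logn_fact_lt (p n : nat) : prime p -> (0 < n)%N ->
  (p.-1 * logn p n`! < n)%N.
Proof.
move=> pp n0; have p0 := prime_gt0 pp.
(* The maximum with 1 carries the strictness through the range of k where the
   quotients vanish. *)
suff H L : (p.-1 * (\sum_(1 <= k < L.+1) n %/ p ^ k) + maxn 1 (n %/ p ^ L)
    <= n)%N.
  by rewrite logn_fact// (leq_trans _ (H n))// -addn1 leq_add2l leq_maxl.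
elim: L => [|L IH].
  by rewrite big_geq// muln0 add0n expn0 divn1 geq_max n0 leqnn.
apply: leq_trans IH; rewrite big_nat_recr//= mulnDr -addnA leq_add2l.
rewrite expnSr divnMA; move: (n %/ p ^ L)%N => m.
have := leq_trunc_div m p; case: (m %/ p)%N => [_|k].
  by rewrite muln0 add0n maxn0 leq_maxl.
case: p p0 {pp} => // p _; rewrite /= mulnS mulnC => H.
by rewrite (maxn_idPr _)// leq_max mulnS; apply/orP; right; lia.
Qed.

Section PadicField.
Context {R : realType} {p : nat} {K : padicComplex R p}.
Hypothesis p_prime : prime p.
Implicit Types (x y t : K) (E F : nat -> K).
Local Open Scope classical_set_scope.

(** The radius of convergence of the exponential. *)
Definition exp_radius : R := p%:R `^ (- (p%:R - 1)^-1).
Local Notation r := exp_radius.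

Let p_gt0 : 0 < p%:R :> R. Proof. by rewrite ltr0n prime_gt0. Qed.

Let p_gt1 : 1 < p%:R :> R. Proof. by rewrite ltr1n prime_gt1. Qed.

Lemma exp_radius_gt0 : 0 < r. Proof. exact: powR_gt0. Qed.

Lemma exp_radiusX : r ^+ p.-1 = p%:R^-1.
Proof.
rewrite -powR_mulrn ?powR_ge0// -powRrM.
have -> : p.-1%:R = p%:R - 1 :> R.
  by rewrite -{2}(prednK (prime_gt0 p_prime)) -natr1 addrK.
by rewrite mulNr mulVf ?subr_eq0 ?gt_eqF// powR_inv1// ltW.
Qed.

Lemma exp_radius_lt1 : r < 1.
Proof.
rewrite -(@expr_lt1 _ p.-1) ?exp_radiusX ?invf_lt1// ?ltW ?exp_radius_gt0//.
by rewrite -ltnS (prednK (prime_gt0 p_prime)) prime_gt1.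
Qed.

(** A Bezout relation u m = v p + 1 forces |u m| = 1, and no natural number
    has absolute value above 1. *)
Lemma abs_natr_coprime m : coprime p m -> abs (m%:R : K) = 1.
Proof.
move=> pm; have m0 : (0 < m)%N.
  by case: m pm => //; rewrite /coprime gcdn0 gtn_eqF// prime_gt1.
apply/le_anti; rewrite abs_natr_le1 /=.
case: (egcdnP p m0) => u v uv _.
have e : (u * m)%:R = (v * p)%:R + 1 :> K.
  by rewrite uv gcdnC (eqP pm) natrD.
have : abs ((u * m)%:R : K) = 1.
  rewrite e abs_perturb abs1// natrM absM Cp_absp.
  rewrite (@le_lt_trans _ _ (1 * p%:R^-1))//.
    by rewrite ler_wpM2r ?abs_natr_le1// invr_ge0 ltW.
  by rewrite mul1r invf_lt1.
rewrite natrM absM => <-.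
by rewrite ler_piMl ?abs_ge0 ?abs_natr_le1.
Qed.

Lemma abs_natr m : (0 < m)%N -> abs (m%:R : K) = p%:R^-1 ^+ logn p m.
Proof.
move=> m0; have [u pu {1}->] := pfactor_coprime p_prime m0.
by rewrite natrM natrX absM absX Cp_absp abs_natr_coprime// mul1r.
Qed.

(** As r ^ (p - 1) = 1 / p, this is the bound (p - 1) v_p(n!) <= n - 1. *)
Lemma abs_fact_ge n : r ^+ n.-1 <= abs (n`!%:R : K).
Proof.
have r0 := ltW exp_radius_gt0.
case: n => [|n]; first by rewrite abs1.
rewrite abs_natr ?fact_gt0// -exp_radiusX -exprM.
apply: ler_wiXn2l => //; first exact: ltW exp_radius_lt1.
by rewrite -ltnS logn_fact_lt.
Qed.

Lemma abs_fact_gt0 n : 0 < abs (n`!%:R : K).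
Proof.
by rewrite (lt_le_trans _ (abs_fact_ge n))// exprn_gt0// exp_radius_gt0.
Qed.

Lemma natr_fact_neq0 n : n`!%:R != 0 :> K.
Proof. by rewrite -abs_eq0 gt_eqF// abs_fact_gt0. Qed.

Lemma abs_exp_term x n : abs (x ^+ n / n`!%:R) <= (abs x / r) ^+ n.
Proof.
rewrite absM absX absV expr_div_n ler_wpM2l ?exprn_ge0 ?abs_ge0//.
rewrite lef_pV2 ?posrE ?abs_fact_gt0 ?exprn_gt0 ?exp_radius_gt0//.
rewrite (le_trans _ (abs_fact_ge n))// ler_wiXn2l ?leq_pred//.
  exact/ltW/exp_radius_gt0.
exact/ltW/exp_radius_lt1.
Qed.

(** The extra factor abs x, which the exponential terms do not have, is what
    bounds the logarithm by |x - 1|: since |n!| <= 1,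
    |n + 1| >= |(n + 1)!| >= r ^ n. *)
Lemma abs_log_term x n :
  abs (x ^+ n.+1 / n.+1%:R) <= abs x * (abs x / r) ^+ n.
Proof.
rewrite absM absX absV exprS -mulrA ler_wpM2l ?abs_ge0// expr_div_n.
rewrite ler_wpM2l ?exprn_ge0 ?abs_ge0//.
have n1 : 0 < abs (n.+1%:R : K).
  by rewrite abs_natr// exprn_gt0// invr_gt0.
rewrite lef_pV2 ?posrE ?exprn_gt0 ?exp_radius_gt0//.
rewrite (le_trans (abs_fact_ge n.+1))// factS natrM absM.
by rewrite ler_piMr ?abs_ge0 ?abs_natr_le1.
Qed.

Lemma ratio_lt1 x : abs x < r -> 0 <= abs x / r < 1.
Proof.
move=> xr; rewrite divr_ge0 ?abs_ge0 ?ltW ?exp_radius_gt0//=.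
by rewrite ltr_pdivrMr ?mul1r// exp_radius_gt0.
Qed.

(** In a complete ultrametric field a series converges as soon as its terms
    tend to 0. *)
Lemma series_geo_cvg (a : nat -> K) (C rho : R) : 0 <= rho < 1 ->
  (forall n, abs (a n) <= C * rho ^+ n) -> exists l : K, series a @ \oo --> l.
Proof.
move=> rho01 aC; apply/cvg_ex; apply: Cp_complete.
apply: cauchy_exP => e e0.
have [N aN] := geometric_lt C rho01 (divr_gt0 e0 (ltr0Sn R 1)).
exists (series a N), N => // n /= Nn; rewrite ballEmdist /=.
rewrite [mdist _ _]absB /series /= -(subnKC Nn).
rewrite (big_cat_nat (leq0n _) (leq_addr _ _))/= addrAC subrr add0r.
apply: (@le_lt_trans _ _ (e / 2)); last first.
  by rewrite ltr_pdivrMr// ltr_pMr// ltr1n.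
rewrite big_nat_cond; apply: abs_sum_le; first by rewrite divr_ge0// ltW.
move=> i /andP[/andP[Ni _] _].
exact: le_trans (aC i) (ltW (aN i Ni)).
Qed.

(** Every term of the logarithmic series is at most |x - 1|. Hence log maps the
    disc of radius r around 1 into the disc on which exp converges. *)
Lemma abs_padic_log x : abs (x - 1) < r -> abs (padic_log x) < r.
Proof.
move=> xr; pose y := x - 1; pose a n := (-1) ^+ n * y ^+ n.+1 / n.+1%:R.
have rho01 := ratio_lt1 xr; have [rho0 rho1] := andP rho01.
have aE n : abs (a n) <= abs y * (abs y / r) ^+ n.
  by rewrite /a -mulrA absM absX absN abs1 expr1n mul1r abs_log_term.
have [l al] := series_geo_cvg rho01 aE.
rewrite /padic_log (ultra_cvg_lim al) (le_lt_trans _ xr)// -[l]subr0.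
apply: (cvg_abs_le al); exists 0%N => n _; rewrite subr0.
apply: abs_sum_le => [|i _]; first exact: abs_ge0.
rewrite (le_trans (aE i))// ler_piMr ?abs_ge0// exprn_ile1// ltW//.
Qed.

End PadicField.

(** * Exponential generating functions with coefficients bounded by 1 *)

Section ExponentialGF.
Context {R : realType} {p : nat} {K : padicComplex R p}.
Hypothesis p_prime : prime p.
Implicit Types (x y t : K) (E F : nat -> K).
Local Open Scope classical_set_scope.
Local Notation r := (@exp_radius R p).

Definition egf_at E t (l : K) :=
  series (fun n => E n * (t ^+ n / n`!%:R)) @ \oo --> l.

Definition unit_bounded E := forall n, abs (E n) <= 1.

Definition binconv E F n : K :=
  \sum_(0 <= k < n.+1) 'C(n, k)%:R * (E k * F (n - k)%N).

Definition delta0 (n : nat) : K := (n == 0%N)%:R.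

Lemma egf_at_unique E t a b : egf_at E t a -> egf_at E t b -> a = b.
Proof. exact: ultra_cvg_unique. Qed.

Lemma eq_egf_at E F t l : E =1 F -> egf_at E t l -> egf_at F t l.
Proof. by move=> /funext ->. Qed.

Lemma abs_egf_term E t n :
  unit_bounded E -> abs (E n * (t ^+ n / n`!%:R)) <= (abs t / r) ^+ n.
Proof.
move=> Ei; rewrite absM (le_trans _ (abs_exp_term p_prime t n))//.
by rewrite ler_piMl ?abs_ge0 ?Ei.
Qed.

Lemma egf_at_ex E t : unit_bounded E -> abs t < r -> exists l, egf_at E t l.
Proof.
move=> Ei tr; apply: (series_geo_cvg (C := 1) (ratio_lt1 p_prime tr)) => n.
by rewrite mul1r abs_egf_term.
Qed.

(** Every term but the first is at most abs t / r < 1. *)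
Lemma egf_at_near0 E t l : unit_bounded E -> abs t < r -> egf_at E t l ->
  abs (l - E 0%N) < 1.
Proof.
move=> Ei tr El; have /andP[rho0 rho1] := ratio_lt1 p_prime tr.
apply: le_lt_trans (rho1); apply: (cvg_abs_le El); exists 1%N => -[//|n] _.
rewrite /series /= big_nat_recl//= expr0 fact0 divr1 mulr1 addrC addKr.
apply: abs_sum_le => // i _; rewrite (le_trans (abs_egf_term _ _ Ei))//.
by rewrite exprS ler_piMr// exprn_ile1// ltW.
Qed.

Lemma egf_atD E F t a b : egf_at E t a -> egf_at F t b ->
  egf_at (fun n => E n + F n) t (a + b).
Proof.
move=> Ea Fb; rewrite /egf_at; have := ultra_cvgD Ea Fb.
set S := (X in X @ _ --> _ -> _) => Sab.
suff -> : series (fun n => (E n + F n) * (t ^+ n / n`!%:R)) = S by [].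
apply/funext => n; rewrite /S.
by rewrite /series /= -big_split; apply: eq_bigr => i _; rewrite mulrDl.
Qed.

Lemma egf_atZ (c : K) E t a : egf_at E t a ->
  egf_at (fun n => c * E n) t (c * a).
Proof.
move=> Ea; rewrite /egf_at; have := ultra_cvgM (@ultra_cvg_cst _ K c) Ea.
set S := (X in X @ _ --> _ -> _) => Sab.
suff -> : series (fun n => c * E n * (t ^+ n / n`!%:R)) = S by [].
apply/funext => n; rewrite /S.
by rewrite /series /= mulr_sumr; apply: eq_bigr => i _; rewrite -mulrA.
Qed.

Lemma egf_at_delta0 t : egf_at delta0 t 1.
Proof.
apply/ultra_cvg_shift; rewrite (_ : (fun _ => _) = fun=> 1).
  exact: ultra_cvg_cst.
apply/funext => n; rewrite /series /= big_nat_recl//= big1 => [|i _].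
  by rewrite /delta0 eqxx expr0 fact0 divr1 mulr1 addr0.
by rewrite /delta0 mul0r.
Qed.

Lemma unit_bounded_delta0 : unit_bounded delta0.
Proof. by move=> n; exact: abs_natr_le1. Qed.

Lemma unit_bounded_binconv E F :
  unit_bounded E -> unit_bounded F -> unit_bounded (binconv E F).
Proof.
move=> Ei Fi n; apply: abs_sum_le => // k _; rewrite !absM.
by rewrite !mulr_ile1 ?abs_ge0 ?mulr_ge0 ?abs_natr_le1 ?abs_ge0 ?Ei ?Fi.
Qed.

Lemma binconv_term E F t n : binconv E F n * (t ^+ n / n`!%:R) =
  \sum_(0 <= i < n.+1) (E i * (t ^+ i / i`!%:R)) *
     (F (n - i)%N * (t ^+ (n - i) / (n - i)`!%:R)).
Proof.
rewrite /binconv mulr_suml big_nat [RHS]big_nat.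
apply: eq_bigr => i /andP[_]; rewrite ltnS => iN.
have fi := natr_fact_neq0 (K := K) p_prime i.
have fni := natr_fact_neq0 (K := K) p_prime (n - i).
have bn : 'C(n, i)%:R != 0 :> K.
  apply/negP => /eqP b0; have /eqP := natr_fact_neq0 (K := K) p_prime n.
  by apply; rewrite -(bin_fact iN) natrM b0 mul0r.
rewrite (_ : t ^+ n = t ^+ i * t ^+ (n - i)); last by rewrite -exprD subnKC.
rewrite -(bin_fact iN) !natrM.
by field; rewrite fi fni bn.
Qed.

(** The Cauchy product of the two series; the bounds on E and F make their terms
    decay geometrically. *)
Lemma egf_at_binconv E F t a b :
  unit_bounded E -> unit_bounded F -> abs t < r ->
  egf_at E t a -> egf_at F t b -> egf_at (binconv E F) t (a * b).
Proof.
move=> Ei Fi tr Ea Fb.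
rewrite /egf_at (funext (binconv_term E F t)).
exact: (cauchy_prod_cvg (ratio_lt1 p_prime tr)
  (fun n => abs_egf_term t n Ei) (fun n => abs_egf_term t n Fi) Ea Fb).
Qed.

Lemma egf_at_exp x : abs x < r -> egf_at (fun=> 1) x (padic_exp x).
Proof.
move=> xr; have i1 : unit_bounded (fun=> 1) by move=> n; rewrite abs1.
have [l xl] := egf_at_ex i1 xr; rewrite /padic_exp.
suff -> : lim (series (fun n => x ^+ n / n`!%:R) @ \oo) = l by [].
apply: ultra_cvg_lim; move: xl; rewrite /egf_at.
by under eq_fun do rewrite mul1r.
Qed.

Lemma abs_expB1_lt1 x : abs x < r -> abs (padic_exp x - 1) < 1.
Proof.
move=> xr; apply: (@egf_at_near0 (fun=> 1) x) => //; last exact: egf_at_exp.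
by move=> n; rewrite abs1.
Qed.

(** The sequence n |-> m ^ n is the m-fold binomial convolution of the constant
    sequence 1. This gives exp (m x) = exp x ^ m directly, without an addition
    formula for exp. *)
Lemma egf_at_expX x m : abs x < r ->
  egf_at (fun n => m%:R ^+ n) x (padic_exp x ^+ m).
Proof.
move=> xr; elim: m => [|m IH].
  by apply: eq_egf_at (egf_at_delta0 x) => n; rewrite expr0n.
rewrite exprSr; apply: eq_egf_at (egf_at_binconv _ _ xr IH (egf_at_exp xr)).
- move=> n; rewrite -natr1 exprDn /binconv big_mkord.
  rewrite (reindex_inj rev_ord_inj) /=; apply: eq_bigr => i _.
  by rewrite subSS bin_sub -1?ltnS// expr1n !mulr1 mulr_natl.
- by move=> n; rewrite -natrX abs_natr_le1.
- by move=> n; rewrite abs1.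
Qed.

Lemma padic_expMn x m : abs x < r ->
  padic_exp (m%:R * x) = padic_exp x ^+ m.
Proof.
move=> xr; apply: ultra_cvg_lim; have := @egf_at_expX x m xr; rewrite /egf_at.
by under eq_fun do rewrite mulrA -exprMn.
Qed.

End ExponentialGF.

(** * Fermionic integrals of powers *)

Section FermionicIntegral.
Context {R : realType} {p : nat} {K : padicComplex R p}.
Hypotheses (p_prime : prime p) (p_odd : odd p).
Implicit Types (w t : K).
Local Open Scope classical_set_scope.

Lemma abs_two : abs (2%:R : K) = 1.
Proof.
apply: abs_natr_coprime => //.
by rewrite coprime_sym prime_coprime// dvdn2 p_odd.
Qed.

Lemma absD1_principal w : abs (w - 1) < 1 -> abs (w + 1) = 1.
Proof.
move=> w1; have -> : w + 1 = (w - 1) + 2%:R by ring.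
by rewrite abs_perturb abs_two.
Qed.

Lemma principal_unitM w z : abs (w - 1) < 1 -> abs (z - 1) < 1 ->
  abs (w * z - 1) < 1.
Proof.
move=> w1 z1.
have -> : w * z - 1 = (w - 1) * (z - 1) + ((w - 1) + (z - 1)) by ring.
apply: absD_lt; last exact: absD_lt.
by rewrite absM mulr_ilt1 ?abs_ge0.
Qed.

Lemma abs_exprB1 w n : abs (w - 1) < 1 -> abs (w ^+ n - 1) <= abs (w - 1).
Proof.
move=> w1; rewrite subrX1 absM ler_piMr ?abs_ge0//.
apply: abs_sum_le => // i _; rewrite absX exprn_ile1 ?abs_ge0//.
by rewrite -[w](subrK 1) absD_le ?abs1// ltW.
Qed.

(** w ^ p - 1 = (w - 1) (1 + w + ... + w ^ (p - 1)), and the second factor is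
    a sum of p terms close to 1, hence close to p, whose size is 1 / p. *)
Lemma abs_expr_pB1 w : abs (w - 1) < 1 ->
  abs (w ^+ p - 1) <= abs (w - 1) * Num.max (abs (w - 1)) p%:R^-1.
Proof.
move=> w1; rewrite subrX1 absM ler_wpM2l ?abs_ge0//.
have -> : \sum_(i < p) w ^+ i = \sum_(i < p) (w ^+ i - 1) + p%:R.
  by rewrite big_split /= sumr_const card_ord mulNrn subrK.
rewrite absD_le//; last by rewrite Cp_absp le_max lexx orbT.
apply: abs_sum_le => [|i _]; first by rewrite le_max abs_ge0.
by rewrite le_max abs_exprB1.
Qed.

(** Each p-th power brings w closer to 1 by a factor max(|w - 1|, 1 / p) or
    better, so that w ^ (p ^ N) tends to 1. *)
Lemma abs_expr_pXB1 w N : abs (w - 1) < 1 ->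
  abs (w ^+ (p ^ N) - 1) <= Num.max (abs (w - 1)) p%:R^-1 ^+ N.+1.
Proof.
move=> w1; set d := Num.max _ _.
have d0 : 0 <= d by rewrite le_max abs_ge0.
have d1 : d <= 1.
  by rewrite ge_max ltW//= invf_le1 ?ler1n ?ltr0n ?prime_gt0//.
elim: N => [|N IH]; first by rewrite expr1 le_max lexx.
have wN1 : abs (w ^+ (p ^ N) - 1) < 1.
  by rewrite (le_lt_trans (abs_exprB1 _ w1)).
rewrite expnSr exprM (le_trans (abs_expr_pB1 wN1))// [leRHS]exprSr.
apply: ler_pM => //; first exact: abs_ge0; first by rewrite le_max abs_ge0.
by rewrite ge_max !le_max abs_exprB1// lexx orbT.
Qed.

Lemma sum_geometric_sign w m : odd m ->
  (\sum_(0 <= x < m) w ^+ x * (-1) ^+ x) * (w + 1) = w ^+ m + 1.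
Proof.
move=> mo; rewrite big_mkord.
have -> : \sum_(i < m) w ^+ i * (-1) ^+ i = \sum_(i < m) (- w) ^+ i.
  by apply: eq_bigr => i _; rewrite [in RHS]exprNn mulrC.
have := subrX1 (- w) m; rewrite exprNn -signr_odd mo expr1 => e.
by rewrite mulrC -[LHS]opprK -mulNr opprD -e; ring.
Qed.

(** The N-th partial sum is (w ^ (p ^ N) + 1) / (w + 1), and |w + 1| = 1. *)
Lemma fermionic_geometric_cvg w : abs (w - 1) < 1 ->
  (fun N => \sum_(0 <= x < p ^ N) w ^+ x * (-1) ^+ x) @ \oo --> 2 / (w + 1).
Proof.
move=> w1; have aw1 := absD1_principal w1.
have w10 : w + 1 != 0 by rewrite -abs_eq0 aw1 oner_neq0.
pose d := Num.max (abs (w - 1)) p%:R^-1.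
apply: (@cvg_abs_geo _ _ _ _ d d) => [|N].
  rewrite le_max abs_ge0 gt_max w1 /= invf_lt1 ?ltr1n ?ltr0n ?prime_gt0//.
  exact: prime_gt1.
rewrite -exprS (le_trans _ (abs_expr_pXB1 N w1))//.
rewrite -[leLHS]mulr1 -aw1 -absM mulrBl sum_geometric_sign ?oddX ?p_odd ?orbT//.
by rewrite divfK// (_ : _ - _ = w ^+ (p ^ N) - 1)//; ring.
Qed.

(** Only the values of f at tuples of natural numbers enter the iterated
    partial sums. The factor A makes the induction go through: integrating out
    the first variable x multiplies it by w ^ x. *)
Lemma fermionic_mint_geometric w (v : nat) (f : v.-tuple K -> K) (A : K) :
  abs (w - 1) < 1 ->
  (forall m : v.-tuple nat,
    f [tuple of [seq i%:R | i <- m]] = A * w ^+ (\sum_(i <- m) i)) ->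
  fermionic_mint f = A * (2 / (w + 1)) ^+ v.
Proof.
move=> w1; elim: v f A => [|v IH] f A fE.
  have := fE [tuple]; rewrite big_nil expr0 mulr1 => <- /=.
  by congr f; apply/val_inj.
rewrite /= /fermionic_int.
have -> : (fun N => \sum_(0 <= x < p ^ N)
      fermionic_mint (fun s => f [tuple of x%:R :: s]) * (-1) ^+ x) =
    (fun N => A * (2 / (w + 1)) ^+ v *
       \sum_(0 <= x < p ^ N) w ^+ x * (-1) ^+ x).
  apply/funext => N; rewrite mulr_sumr; apply: eq_bigr => x _.
  rewrite (IH _ (A * w ^+ x)); first by ring.
  move=> m; rewrite -mulrA -exprD.
  have := fE [tuple of x :: m]; rewrite big_cons => <-.
  by congr f; apply/val_inj.
apply: ultra_cvg_lim; rewrite exprSr (mulrA A).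
exact: (ultra_cvgM (@ultra_cvg_cst R K _) (fermionic_geometric_cvg w1)).
Qed.

End FermionicIntegral.

(** * Uniqueness of the coefficients *)

Section Uniqueness.
Context {R : realType} {p : nat} {K : padicComplex R p}.
Hypothesis p_prime : prime p.
Local Open Scope classical_set_scope.

Let pV01 : 0 <= (p%:R^-1 : R) < 1.
Proof.
by rewrite invr_ge0 ler0n invf_lt1 ?ltr1n ?ltr0n ?prime_gt0 ?prime_gt1.
Qed.

(** Let k be the first index with D k != 0. Evaluated at t = p ^ (m0 + m), the
    term of index k has size p ^ (- m k) up to a positive constant, and all
    later terms are at most p ^ (- m (k + 1)) up to a constant. For m large
    they cannot cancel it. *)
Lemma egf_at0_coef_eq0 (D : nat -> K) :
  (\forall t \near (0 : K), egf_at D t 0) -> forall n, D n = 0.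
Proof.
move=> /nbhs_ballP[e /= e0 De].
have Dt (t : K) : abs t < e -> egf_at D t 0.
  by move=> te; apply: De; rewrite /= ballEmdist /= [mdist _ _]absB subr0.
have absp m : abs ((p%:R : K) ^+ m) = p%:R^-1 ^+ m by rewrite absX Cp_absp.
have [m0 Hm0] := geometric_lt 1 pV01 e0.
(* The choice of m0 makes the series converge at p ^ m0, so its terms there
   are bounded. *)
have [M0 DM0] : exists M, forall n,
    abs (D n * ((p%:R ^+ m0) ^+ n / n`!%:R)) <= M.
  pose a n := D n * ((p%:R ^+ m0) ^+ n / n`!%:R).
  have /cvg_absP/(_ 1 ltr01)[N HN] : egf_at D (p%:R ^+ m0) 0.
    by apply: Dt; rewrite absp -[X in X < _]mul1r Hm0.
  have aS n : a n = series a n.+1 - series a n.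
    by rewrite /series /= big_nat_recr//=; ring.
  have aN n : (N <= n)%N -> abs (a n) <= 1.
    move=> Nn; rewrite aS absD_le// ?absN -[X in abs X]subr0 ltW// HN//.
    exact: leqW.
  exists (1 + \sum_(i < N) abs (a i)) => n; rewrite -/(a n).
  have [Nn|nN] := leqP N n.
    by rewrite (le_trans (aN n Nn))// lerDl sumr_ge0// => i _; exact: abs_ge0.
  rewrite (bigD1 (Ordinal nN))//= addrCA lerDl addr_ge0// sumr_ge0// => i _.
  exact: abs_ge0.
move=> n; elim/ltn_ind: n => k IH.
apply/eqP; rewrite -[D k == 0]negbK; apply/negP => Dk0.
pose b := D k * ((p%:R ^+ m0) ^+ k / k`!%:R).
have pn0 : (p%:R : K) != 0.
  by rewrite -abs_eq0 Cp_absp invr_eq0 pnatr_eq0 -lt0n prime_gt0.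
have b0 : 0 < abs b.
  rewrite lt_neqAle abs_ge0 andbT eq_sym abs_eq0 /b.
  by rewrite !mulf_neq0 ?expf_neq0 ?invr_eq0 ?natr_fact_neq0.
have [m Hm] := geometric_lt M0 pV01 b0.
have {}Hm := Hm m (leqnn m).
have M00 : 0 <= M0 by exact: le_trans (abs_ge0 _) (DM0 0%N).
have [pV0 pV1] := andP pV01.
pose t : K := p%:R ^+ (m0 + m).
have term n : D n * (t ^+ n / n`!%:R) =
    (D n * ((p%:R ^+ m0) ^+ n / n`!%:R)) * (p%:R ^+ m) ^+ n.
  by rewrite /t exprD exprMn; ring.
have St : egf_at D t 0.
  by apply: Dt; rewrite absp -[X in X < _]mul1r Hm0// leq_addr.
have : abs (0 - b * (p%:R ^+ m) ^+ k) <= M0 * (p%:R^-1 ^+ m) ^+ k.+1.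
  apply: (cvg_abs_le St); exists k.+1 => N kN; rewrite /series /=.
  rewrite (big_cat_nat (leq0n _) kN)/= big_nat_recr//=.
  rewrite big_nat_cond big1 => [|i /andP[/andP[_ ik] _]]; last first.
    by rewrite IH// mul0r.
  rewrite add0r term addrAC subrr add0r big_nat_cond.
  apply: abs_sum_le => [|i /andP[/andP[ki _] _]].
    by rewrite mulr_ge0// !exprn_ge0.
  rewrite term absM absX absp ler_pM ?abs_ge0 ?exprn_ge0//.
  by rewrite ler_wiXn2l ?exprn_ge0 ?exprn_ile1// ltW.
rewrite sub0r absN absM absX absp exprS mulrA ler_pM2r.
  by rewrite leNgt Hm.
by rewrite !exprn_gt0// invr_gt0 ltr0n prime_gt0.
Qed.

Lemma is_egf_unique (F : K -> K) (E E' : nat -> K) :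
  is_egf F E -> is_egf F E' -> E =1 E'.
Proof.
move=> FE FE' n; apply/eqP; rewrite -subr_eq0 -mulN1r; apply/eqP.
apply: (@egf_at0_coef_eq0 (fun n => E n + -1 * E' n)).
near=> t; have -> : 0 = F t + -1 * F t by ring.
apply: egf_atD; last apply: egf_atZ.
  by near: t.
by near: t.
Unshelve. all: by end_near. Qed.

Lemma egf_coefE (F : K -> K) (E : nat -> K) : is_egf F E -> egf_coef F =1 E.
Proof. by move=> FE; apply: (is_egf_unique _ FE); exact: getI FE. Qed.

Lemma is_egf_disc (F : K -> K) (E : nat -> K) :
  (forall t, abs t < @exp_radius R p -> egf_at E t (F t)) -> is_egf F E.
Proof.
move=> H; apply/nbhs_ballP; exists (@exp_radius R p).
  exact: exp_radius_gt0.
by move=> t; rewrite ballEmdist /= [mdist _ _]absB subr0 => /H.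
Qed.

End Uniqueness.

(** * Euler numbers and their binomial convolutions *)

(** Expanding the power picks one monomial in each of the v factors, that is
    one index l j for each j. *)
Lemma coef_exp_multinomial (A : comNzRingType) (a : nat -> A) v n :
  ((\poly_(i < n.+1) a i) ^+ v)`_n =
  \sum_(l : {ffun 'I_v -> 'I_n.+1} | (\sum_(j < v) l j)%N == n)
     \prod_(j < v) a (l j).
Proof.
rewrite poly_def (_ : _ ^+ v = \prod_(j < v) \sum_(i < n.+1) a i *: 'X^i);
  last by rewrite prodr_const card_ord.
rewrite (bigA_distr_bigA (fun (j : 'I_v) (i : 'I_n.+1) => a i *: 'X^i)).
rewrite coef_sum.
rewrite [RHS]big_mkcond; apply: eq_bigr => l _.
have -> : \prod_(i < v) (a (l i) *: 'X^(l i)) =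
    (\prod_(j < v) a (l j)) *: 'X^(\sum_(j < v) l j)%N :> {poly A}.
  by rewrite scaler_prod -prodrXr.
by rewrite coefZ coefXn eq_sym; case: eqP => _; rewrite ?mulr1 ?mulr0.
Qed.

Section EulerNumbers.
Context {R : realType} {p : nat} {K : padicComplex R p}.
Hypotheses (p_prime : prime p) (p_odd : odd p).
Implicit Types (c t : K) (E : nat -> K).
Local Notation r := (@exp_radius R p).

(** The list of the first n coefficients: course-of-values recursion by
    accumulation. *)
Fixpoint euler_seq (c : K) n : seq K :=
  if n is m.+1 then
    rcons (euler_seq c m)
      ((2 * delta0 m - c * \sum_(0 <= k < m) 'C(m, k)%:R * (euler_seq c m)`_k)
         / (c + 1))
  else [::].

(** The coefficients of 2 / (c e ^ t + 1), obtained by solving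
    E * (c e ^ t + 1) = 2 degree by degree. *)
Definition euler_coef c n : K := (euler_seq c n.+1)`_n.

Lemma size_euler_seq c n : size (euler_seq c n) = n.
Proof. by elim: n => //= n IH; rewrite size_rcons IH. Qed.

Lemma nth_euler_seq c n k : (k < n)%N -> (euler_seq c n)`_k = euler_coef c k.
Proof.
elim: n => // n IH; rewrite ltnS leq_eqVlt => /orP[/eqP->//|kn].
by rewrite /= nth_rcons size_euler_seq kn IH.
Qed.

Lemma euler_coef_rec c n : euler_coef c n =
  (2 * delta0 n - c * \sum_(0 <= k < n) 'C(n, k)%:R * euler_coef c k) / (c + 1).
Proof.
rewrite {1}/euler_coef /= nth_rcons size_euler_seq ltnn eqxx.
congr ((_ - c * _) / _); rewrite big_nat [RHS]big_nat.
by apply: eq_bigr => i /andP[_ iN]; rewrite nth_euler_seq.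
Qed.

(** The recursion only divides by c + 1, and |c + 1| = |2| = 1 as p is odd. *)
Lemma unit_bounded_euler_coef c :
  abs (c - 1) < 1 -> unit_bounded (euler_coef c).
Proof.
move=> c1; have c11 := absD1_principal p_prime p_odd c1.
have cle1 : abs c <= 1 by rewrite -[c](subrK 1) absD_le ?abs1// ltW.
move=> n; elim/ltn_ind: n => n IH.
rewrite euler_coef_rec absM absV c11 invr1 mulr1 absD_le//.
  by rewrite /delta0 -natrM abs_natr_le1.
rewrite absN absM mulr_ile1 ?abs_ge0//.
rewrite big_nat_cond; apply: abs_sum_le => // i /andP[/andP[_ iN] _].
by rewrite absM mulr_ile1 ?abs_ge0 ?abs_natr_le1 ?IH.
Qed.

Lemma euler_coef_binconv c n : abs (c - 1) < 1 ->
  binconv (euler_coef c) (fun n => c * 1 + delta0 n) n = 2 * delta0 n.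
Proof.
move=> c1; have c11 := absD1_principal p_prime p_odd c1.
have c10 : c + 1 != 0 by rewrite -abs_eq0 c11 oner_neq0.
rewrite /binconv big_nat_recr//= subnn binn (euler_coef_rec c n).
rewrite (_ : \sum_(0 <= i < n) _ =
    c * \sum_(0 <= k < n) 'C(n, k)%:R * euler_coef c k).
  by rewrite (_ : delta0 0 = 1 :> K)//; field.
rewrite mulr_sumr big_nat [RHS]big_nat; apply: eq_bigr => i /andP[_ iN].
by rewrite /delta0 subn_eq0 leqNgt iN /=; ring.
Qed.

(** The sum exists by boundedness alone; multiplying it by c e ^ t + 1 gives 2,
    and c e ^ t + 1 does not vanish because |c e ^ t - 1| < 1. *)
Lemma egf_at_euler_coef c t : abs (c - 1) < 1 -> abs t < r ->
  egf_at (euler_coef c) t (2 / (c * padic_exp t + 1)).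
Proof.
move=> c1 tr; have Ei := unit_bounded_euler_coef c1.
have [l El] := egf_at_ex p_prime Ei tr.
have Ge := egf_atD (@egf_atZ _ _ _ c _ _ _ (egf_at_exp p_prime tr))
  (@egf_at_delta0 _ _ K t).
have Gi : unit_bounded (fun n => c * 1 + delta0 n).
  move=> n; rewrite absD_le ?abs_natr_le1// mulr1.
  by rewrite -[c](subrK 1) absD_le ?abs1// ltW.
have ll := egf_at_binconv p_prime Ei Gi tr El Ge.
have l2 := @egf_atZ _ _ _ 2 _ _ _ (@egf_at_delta0 _ _ K t).
have := egf_at_unique (eq_egf_at (fun n => euler_coef_binconv n c1) ll) l2.
rewrite mulr1 => e; rewrite -e mulfK//.
rewrite -abs_eq0 (absD1_principal p_prime p_odd) ?oner_neq0//.
exact: principal_unitM c1 (abs_expB1_lt1 p_prime tr).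
Qed.

Fixpoint binconv_pow E v : nat -> K :=
  if v is v'.+1 then binconv E (binconv_pow E v') else delta0.

Lemma unit_bounded_binconv_pow E v :
  unit_bounded E -> unit_bounded (binconv_pow E v).
Proof.
move=> Ei; elim: v => [|v IH]; first exact: unit_bounded_delta0.
exact: unit_bounded_binconv.
Qed.

Lemma egf_at_binconv_pow E v t l :
  unit_bounded E -> abs t < r -> egf_at E t l ->
  egf_at (binconv_pow E v) t (l ^+ v).
Proof.
move=> Ei tr El; elim: v => [|v IH]; first exact: egf_at_delta0.
by rewrite exprS; apply: egf_at_binconv => //; exact: unit_bounded_binconv_pow.
Qed.

(** Truncating the generating function at any degree N > n leaves the n-th
    coefficient of its powers unchanged; a common N for all n allows the
    induction on v. *)
Lemma binconv_pow_poly E v N n : (n < N)%N ->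
  binconv_pow E v n =
  n`!%:R * ((\poly_(i < N) (E i / i`!%:R)) ^+ v)`_n.
Proof.
elim: v n => [|v IH] n nN /=.
  rewrite expr0 coef1 /delta0; case: n nN => [|n] _; rewrite ?mulr0//.
  by rewrite fact0 mulr1.
rewrite exprS coefM /binconv big_mkord mulr_sumr; apply: eq_bigr => i _.
have iN : (i <= n)%N by rewrite -ltnS.
rewrite coef_poly (leq_ltn_trans iN nN) IH ?(leq_ltn_trans (leq_subr _ _))//.
have fi := natr_fact_neq0 (K := K) p_prime i.
by rewrite -(bin_fact iN) !natrM; field.
Qed.

Lemma binconv_pow_multinomial E v n :
  binconv_pow E v n =
  \sum_(l : {ffun 'I_v -> 'I_n.+1} | (\sum_(j < v) l j)%N == n)
     multinomial l * \prod_(j < v) E (l j).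
Proof.
rewrite (binconv_pow_poly E v (ltnSn n)) coef_exp_multinomial mulr_sumr.
apply: eq_bigr => l _; rewrite /multinomial big_split /= prodfV.
by rewrite mulrA mulrAC.
Qed.

Section FixedParameters.
Variables (q : K) (h : int).
Hypothesis hq : abs (q - 1) < r.

Let c := padic_pow q h%:~R.

Let log_radius : abs (h%:~R * padic_log q) < r.
Proof.
rewrite absM (le_lt_trans _ (abs_padic_log p_prime hq))//.
by rewrite ler_piMl ?abs_ge0 ?abs_intr_le1.
Qed.

Let c1 : abs (c - 1) < 1. Proof. exact: abs_expB1_lt1. Qed.

Lemma hq_eulerE : hq_euler h q =1 euler_coef c.
Proof.
apply: egf_coefE => //; apply: is_egf_disc => // t tr.
exact: egf_at_euler_coef.
Qed.

(** At natural numbers x_j of sum m the integrand is w ^ m for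
    w = c e ^ t. *)
Lemma fermionic_hq t v : abs t < r ->
  fermionic_mint (fun x : v.-tuple K =>
    padic_pow q (\sum_(j < v) h%:~R * tnth x j) *
    padic_exp (t * \sum_(j < v) tnth x j)) =
  (2 / (c * padic_exp t + 1)) ^+ v.
Proof.
move=> tr; rewrite -[RHS]mul1r.
apply: fermionic_mint_geometric => // [|m].
  exact: principal_unitM c1 (abs_expB1_lt1 p_prime tr).
rewrite -mulr_sumr (_ : \sum_(j < v) _ = (\sum_(i <- m) i)%:R).
  rewrite mul1r exprMn /c /padic_pow -!padic_expMn//.
  by congr (padic_exp _ * padic_exp _); ring.
rewrite -(big_tuple _ _ [tuple of [seq i%:R | i <- m]] xpredT id) /=.
by rewrite big_map natr_sum.
Qed.

Lemma hq_euler_orderE v :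
  hq_euler_order h v q =1 binconv_pow (euler_coef c) v.
Proof.
apply: egf_coefE => //; apply: is_egf_disc => // t tr.
rewrite fermionic_hq//; apply: egf_at_binconv_pow => //.
  exact: unit_bounded_euler_coef.
exact: egf_at_euler_coef.
Qed.

End FixedParameters.
End EulerNumbers.

Theorem theorem7 (R : realType) (p : nat) (K : padicComplex R p)
    (p_prime : prime p) (p_odd : odd p)
    (q : K) (hq : abs (q - 1) < p%:R `^ (- (p%:R - 1)^-1)) (h : int)
    (n v : nat) (n_gt0 : (0 < n)%N) (v_gt0 : (0 < v)%N) :
  hq_euler_order h v q n =
    \sum_(l : {ffun 'I_v -> 'I_n.+1} | (\sum_(j < v) l j)%N == n)
      multinomial l * \prod_(j < v) hq_euler h q (l j).
Proof.
rewrite hq_euler_orderE// binconv_pow_multinomial//; apply: eq_bigr => l _.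
by congr (_ * _); apply: eq_bigr => j _; rewrite hq_eulerE.
Qed.
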